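(* Let $n\ge 1$ and $T\ge n$ be integers, let $U=\begin{bmatrix}\bar u_0&\cdots&\bar u_T\end{bmatrix}$ and $Y=\begin{bmatrix}\bar y_0&\cdots&\bar y_T\end{bmatrix}$ be real input-output data generated by some system of order $n$ (so that the set $\Sigma_{U,Y}$ defined in the context is nonempty), and let $\sigma\in\mathbb{C}$. Then the data $(U,Y)$ is informative for interpolation at $\sigma$ (i.e., there exists a unique $M\in\mathbb{C}$ such that $\Sigma_{U,Y}\subseteq\Sigma_{\sigma,M}$) if and only if both $$\operatorname{rank}\begin{bmatrix}H_n(U)&0&\gamma_n(\sigma)\\ H_n(Y)&\gamma_n(\sigma)&0\end{bmatrix}=\operatorname{rank}\begin{bmatrix}H_n(U)&0\\ H_n(Y)&\gamma_n(\sigma)\end{bmatrix}$$ and $$\operatorname{rank}\begin{bmatrix}H_n(U)&0\\ H_n(Y)&\gamma_n(\sigma)\end{bmatrix}=\operatorname{rank}\begin{bmatrix}H_n(U)\\ H_n(Y)\end{bmatrix}+1 .$$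
   Context: A system of order $n$ is a discrete-time input-output equation $$y_{t+n}+p_{n-1}y_{t+n-1}+\cdots+p_1y_{t+1}+p_0y_t=q_nu_{t+n}+q_{n-1}u_{t+n-1}+\cdots+q_1u_{t+1}+q_0u_t,$$ parameterized by the real row vector $\begin{bmatrix}q&-p\end{bmatrix}\in\mathbb{R}^{1\times(2n+1)}$, where $p=\begin{bmatrix}p_0&\cdots&p_{n-1}\end{bmatrix}\in\mathbb{R}^{1\times n}$ and $q=\begin{bmatrix}q_0&\cdots&q_n\end{bmatrix}\in\mathbb{R}^{1\times(n+1)}$. For $U=\begin{bmatrix}\bar u_0&\cdots&\bar u_T\end{bmatrix}$, the Hankel matrix of depth $\ell$ is $$H_\ell(U)=\begin{bmatrix}\bar u_0&\bar u_1&\cdots&\bar u_{T-\ell}\\ \bar u_1&\bar u_2&\cdots&\bar u_{T-\ell+1}\\ \vdots&\vdots&\ddots&\vdots\\ \bar u_\ell&\bar u_{\ell+1}&\cdots&\bar u_T\end{bmatrix}\in\mathbb{R}^{(\ell+1)\times(T-\ell+1)};$$ $H_\ell(Y)$ is defined similarly, and $\bar H_n(Y)$ is $H_n(Y)$ with its last row removed. For $z\in\mathbb{C}$, $\gamma_\ell(z)=\begin{bmatrix}1&z&\cdots&z^\ell\end{bmatrix}^\top\in\mathbb{C}^{\ell+1}$. The set of systems explaining the data is $$\Sigma_{U,Y}=\left\{\begin{bmatrix}q&-p\end{bmatrix}\in\mathbb{R}^{1\times(2n+1)}\ \middle|\ \begin{bmatrix}q&-p\end{bmatrix}\begin{bmatrix}H_n(U)\\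 \bar H_n(Y)\end{bmatrix}=\begin{bmatrix}\bar y_n&\bar y_{n+1}&\cdots&\bar y_T\end{bmatrix}\right\}.$$ Standing assumption: the data are generated by a (unknown) true system $\begin{bmatrix}\bar q&-\bar p\end{bmatrix}$ of order $n$, i.e., $\begin{bmatrix}\bar q&-\bar p\end{bmatrix}\in\Sigma_{U,Y}$. For $\sigma,M\in\mathbb{C}$, the set of systems with transfer function value $M$ at $\sigma$, i.e., with $P(\sigma)M=Q(\sigma)$ where $P(z)=z^n+p_{n-1}z^{n-1}+\cdots+p_0$ and $Q(z)=q_nz^n+\cdots+q_0$, is $$\Sigma_{\sigma,M}=\left\{\begin{bmatrix}q&-p\end{bmatrix}\in\mathbb{R}^{1\times(2n+1)}\ \middle|\ \begin{bmatrix}q&-p\end{bmatrix}\begin{bmatrix}\gamma_n(\sigma)\\ M\gamma_{n-1}(\sigma)\end{bmatrix}=M\sigma^n\right\}.$$ The data $(U,Y)$ is called informative for interpolation at $\sigma$ if there exists a unique $M\in\mathbb{C}$ such that $\Sigma_{U,Y}\subseteq\Sigma_{\sigma,M}$. Ranks are over $\mathbb{C}$. *)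

(* Defs.v *)
From mathcomp Require Import all_boot all_order all_algebra.
From mathcomp Require Import complex.
From mathcomp Require Import classical_sets reals.

Set Implicit Arguments.
Unset Strict Implicit.
Unset Printing Implicit Defensive.

Import Order.TTheory GRing.Theory Num.Theory.

Local Open Scope ring_scope.
Local Open Scope complex_scope.
Local Open Scope classical_set_scope.

(* Meaningful for l <= T only: then i + j <= T, so that [inord] is exact and
   (T - l).+1 is the intended number of columns. *)
Definition hankel (R : realType) (T l : nat) (U : 'rV[R]_T.+1) :
    'M[R]_(l.+1, (T - l).+1) :=
  \matrix_(i, j) U ord0 (inord (i + j)).

Definition hankel_bar (R : realType) (T n : nat) (Y : 'rV[R]_T.+1) :
    'M[R]_(n, (T - n).+1) :=
  row' ord_max (hankel n Y).

Definition output_row (R : realType) (T n : nat) (Y : 'rV[R]_T.+1) :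
    'rV[R]_(T - n).+1 :=
  \row_j Y ord0 (inord (n + j)).

(* The first argument is the number of entries, not the top exponent: the
   column (1, z, ..., z^l)^T is [gamma l.+1 z]. *)
Definition gamma (R : realType) (m : nat) (z : R[i]) : 'cV[R[i]]_m :=
  \col_(i < m) z ^+ i.

(* A system of order n is the row [row_mx q (- p)], with q of length n.+1 and
   p of length n. *)
Definition Sigma_data (R : realType) (T n : nat) (U Y : 'rV[R]_T.+1) :
    set 'rV[R]_(n.+1 + n) :=
  [set s | s *m col_mx (hankel n U) (hankel_bar n Y) = output_row n Y].
Arguments Sigma_data {R T} n U Y.

Definition mxC (R : realType) (m k : nat) (A : 'M[R]_(m, k)) : 'M[R[i]]_(m, k) :=
  map_mx (real_complex R) A.

(* [row_mx q (- p)] belongs to this set iff P(sigma) M = Q(sigma), where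
   P = z^n + p_(n-1) z^(n-1) + ... + p_0 and Q = q_n z^n + ... + q_0. *)
Definition Sigma_value (R : realType) (n : nat) (sigma M : R[i]) :
    set 'rV[R]_(n.+1 + n) :=
  [set s | mxC s *m col_mx (gamma n.+1 sigma) (M *: gamma n sigma)
           = (M * sigma ^+ n)%:M].
Arguments Sigma_value {R} n sigma M.

Definition informative_for_interpolation (R : realType) (T n : nat)
    (U Y : 'rV[R]_T.+1) (sigma : R[i]) : Prop :=
  exists! M : R[i], Sigma_data n U Y `<=` Sigma_value n sigma M.

(* Main.v *)
Require Import Defs.
From mathcomp Require Import all_boot all_order all_algebra.
From mathcomp Require Import complex.
From mathcomp Require Import classical_sets reals.
From mathcomp Require Import zify.

Set Implicit Arguments.
Unset Strict Implicit.
Unset Printing Implicit Defensive.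

Import Order.TTheory GRing.Theory Num.Theory.

Local Open Scope ring_scope.
Local Open Scope complex_scope.
Local Open Scope classical_set_scope.

(** Write [D] for the stacked Hankel matrix, [a] for [gamma] placed in the input
    rows and [b] for [gamma] placed in the output rows.  A system explaining the
    data is a real left-kernel vector of [D] with last entry -1.  Since one such
    vector exists, these span the real left kernel of [D], and [D]
    being real, they also determine the complex column space of [D].  Hence the
    inclusion in [Sigma_value n sigma M] says that [a + M b] lies in that column
    space: existence of [M] means that [a] lies in the span of [D] and [b], and
    uniqueness means that [b] does not lie in the span of [D]. *)

Section ColumnSpace.
Variables (F : fieldType) (m k : nat).
Implicit Types (A : 'M[F]_(m, k)) (v : 'cV[F]_m).

(** The order [<=] on matrices compares row spaces, hence the transposes. A column outside the span
    makes the inclusion of spans strict, so the rank grows, and by at most one. *)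
Lemma mxrank_row_mx_col A v :
  \rank (row_mx A v) = (\rank A + ~~ (v^T <= A^T)%MS)%N.
Proof.
rewrite -mxrank_tr tr_row_mx -addsmxE -[\rank A]mxrank_tr.
have [vA | vNA] := boolP (v^T <= A^T)%MS.
  by rewrite addn0 (addsmx_idPl vA).
apply/eqP; rewrite eqn_leq; apply/andP; split.
  by rewrite (leq_trans (mxrank_adds_leqif _ _)) // leq_add2l rank_leq_row.
rewrite addn1; apply: rank_ltmx.
by rewrite ltmxE addsmxSl addsmx_sub submx_refl.
Qed.

Lemma sub_tr_row_mx A (b a : 'cV[F]_m) :
  (a^T <= (row_mx A b)^T)%MS <-> exists M, ((a + M *: b)^T <= A^T)%MS.
Proof.
rewrite tr_row_mx -addsmxE; split.
  case/sub_addsmxP=> -[x y] /= aE; exists (- y 0 0).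
  rewrite linearD linearZ /= aE [y]mx11_scalar mul_scalar_mx !mxE /=.
  by rewrite mulr1n scaleNr addrK submxMl.
case=> M abA; have -> : a^T = (a + M *: b)^T - M *: b^T.
  by rewrite linearD linearZ /= addrK.
apply: addmx_sub_adds => //; by rewrite eqmx_opp scalemx_sub.
Qed.

(** Distinct solutions [M] and [N] differ by [(M - N) *: b], which forces [b] into the span; if [b]
    lies there, [M + 1] is a second solution. *)
Lemma unique_submx_shift A (b a : 'cV[F]_m) :
  (exists! M, ((a + M *: b)^T <= A^T)%MS) <->
  (exists M, ((a + M *: b)^T <= A^T)%MS) /\ ~~ (b^T <= A^T)%MS.
Proof.
split=> [[M [MA Muniq]] | [[M MA] bNA]].
  split; first by exists M.
  apply/negP => bA; have /Muniq/eqP : ((a + (M + 1) *: b)^T <= A^T)%MS.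
    by rewrite scalerDl scale1r addrA linearD /= addmx_sub.
  by rewrite -subr_eq0 opprD addNKr oppr_eq0 oner_eq0.
exists M; split=> // N NA; apply/eqP; rewrite -subr_eq0.
apply: contraNT bNA => MN0; rewrite -(eqmx_scale _ MN0) -linearZ /=.
have -> : (M - N) *: b = (a + M *: b) - (a + N *: b).
  by rewrite scalerBl opprD addrACA subrr add0r.
by rewrite linearB /= addmx_sub // eqmx_opp.
Qed.

End ColumnSpace.

Lemma row'_mulmx (F : pzRingType) (m k l : nat) (i : 'I_m)
    (A : 'M[F]_(m, k)) (B : 'M[F]_(k, l)) :
  row' i (A *m B) = row' i A *m B.
Proof. by apply/matrixP => r j; rewrite !mxE; apply: eq_bigr => t _; rewrite mxE. Qed.

Definition drop_last (F : Type) (m n : nat) (w : 'rV[F]_(m + n.+1)) :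
    'rV[F]_(m + n) :=
  row_mx (lsubmx w) (col' ord_max (rsubmx w)).

(** For [B] equal to [hankel n Y] or [M *: gamma n.+1 sigma], this separates the two sides of the
    equation of [Sigma_data] or [Sigma_value]. *)
Lemma mul_row_col_last (F : pzRingType) (m n k : nat) (w : 'rV[F]_(m + n.+1))
    (A : 'M[F]_(m, k)) (B : 'M[F]_(n.+1, k)) :
  w *m col_mx A B = drop_last w *m col_mx A (row' ord_max B)
                    + w 0 (rshift m ord_max) *: row ord_max B.
Proof.
rewrite -{1}[w]hsubmxK !mul_row_col -addrA; congr (_ + _).
apply/rowP => j; rewrite !mxE big_ord_recr /= !mxE; congr (_ + _).
apply: eq_bigr => i _; rewrite !mxE.
suff -> : widen_ord (leqnSn n) i = lift ord_max i by [].
by apply: val_inj; rewrite /= /bump leqNgt ltn_ord.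
Qed.

Section Data.
Variables (R : realType) (n T : nat) (U Y : 'rV[R]_T.+1) (sigma : R[i]).

Let D : 'M[R]_(n.+1 + n.+1, (T - n).+1) := col_mx (hankel n U) (hankel n Y).

Lemma row_max_hankel : row ord_max (hankel n Y) = output_row n Y.
Proof. by apply/rowP => j; rewrite !mxE. Qed.

Lemma row'_gamma : row' ord_max (gamma n.+1 sigma) = gamma n sigma.
Proof. by apply/colP => i; rewrite !mxE /= /bump leqNgt ltn_ord. Qed.

Lemma row'_scale_gamma (M : R[i]) :
  row' ord_max (M *: gamma n.+1 sigma) = M *: gamma n sigma.
Proof. by rewrite -row'_gamma; apply/colP => i; rewrite !mxE. Qed.

Lemma row_max_scale_gamma (M : R[i]) :
  row ord_max (M *: gamma n.+1 sigma) = (M * sigma ^+ n)%:M.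
Proof. by apply/rowP => j; rewrite ord1 !mxE. Qed.

(** If the column is [mxC D *m x^T], the complexified equation of [Sigma_data] multiplied on the
    right by [x^T] is that of [Sigma_value]. *)
Lemma Sigma_value_of_submx (M : R[i]) :
  ((col_mx (gamma n.+1 sigma) (M *: gamma n.+1 sigma))^T <= (mxC D)^T)%MS ->
  Sigma_data n U Y `<=` Sigma_value n sigma M.
Proof.
case/submxP=> x /(congr1 trmx); rewrite trmx_mul !trmxK /mxC map_col_mx.
rewrite mul_col_mx => /eq_col_mx[gU gY] s sD.
rewrite /Sigma_value /= -row'_scale_gamma -row_max_scale_gamma gY gU.
rewrite row'_mulmx -mul_col_mx mulmxA row_mul; congr (_ *m _).
rewrite -map_row' -map_col_mx -map_mxM -map_row row_max_hankel.
by congr map_mx; exact: sD.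
Qed.

Lemma submx_of_Sigma_value (M : R[i]) :
  Sigma_data n U Y !=set0 -> Sigma_data n U Y `<=` Sigma_value n sigma M ->
  ((col_mx (gamma n.+1 sigma) (M *: gamma n.+1 sigma))^T <= (mxC D)^T)%MS.
Proof.
move=> [s0 s0D] sub.
have kerP (w : 'rV[R]_(n.+1 + n.+1)) : w *m D = 0 ->
    mxC w *m col_mx (gamma n.+1 sigma) (M *: gamma n.+1 sigma) = 0.
  rewrite !mul_row_col_last row_max_hankel row'_scale_gamma row_max_scale_gamma.
  set c := w 0 _ => /eqP; rewrite addr_eq0 => /eqP wD.
  (* normalises the last entry to -1 without dividing by it *)
  have : Sigma_data n U Y (drop_last w + (1 + c) *: s0).
    rewrite /Sigma_data /= mulmxDl -scalemxAl wD s0D scalerDl scale1r.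
    by rewrite addrCA addNr addr0.
  (* By linearity, the term in [s0] contributes [1 + c] times the right-hand side; cancelling one
     copy leaves the kernel equation. *)
  move/sub; rewrite /Sigma_value /= /mxC map_mxD map_mxZ mulmxDl -scalemxAl.
  rewrite (sub _ s0D) rmorphD rmorph1 scalerDl scale1r addrCA.
  move/(canRL (addKr _)); rewrite addNr.
  have -> : drop_last (map_mx (real_complex R) w) = mxC (drop_last w).
    by apply/rowP => i; rewrite !mxE; case: split => j; rewrite !mxE.
  by rewrite mxE.
(* The cokernel commutes with the embedding of the reals, so complex membership is tested on real
   vectors only, one row at a time by [kerP]. *)
rewrite submxE /mxC map_trmx -map_cokermx -[map_mx _ _]trmxK -trmx_mul.
rewrite -trmx0; apply/eqP; congr trmx; rewrite map_trmx.
apply/row_matrixP => i; rewrite row_mul row0 -map_row; apply: kerP.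
rewrite -row_mul -[X in _ *m X]trmxK -trmx_mul mulmx_coker.
by rewrite trmx0 row0.
Qed.

End Data.

Theorem theorem6 (R : realType) (n T : nat) (U Y : 'rV[R]_T.+1) (sigma : R[i])
    (n_ge1 : (1 <= n)%N) (n_le_T : (n <= T)%N)
    (data_generated : Sigma_data n U Y !=set0) :
  informative_for_interpolation n U Y sigma <->
  \rank (col_mx
      (row_mx (row_mx (mxC (hankel n U)) (0 : 'cV[R[i]]_n.+1)) (gamma n.+1 sigma))
      (row_mx (row_mx (mxC (hankel n Y)) (gamma n.+1 sigma)) (0 : 'cV[R[i]]_n.+1)))
  = \rank (col_mx
      (row_mx (mxC (hankel n U)) (0 : 'cV[R[i]]_n.+1))
      (row_mx (mxC (hankel n Y)) (gamma n.+1 sigma)))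
  /\
  \rank (col_mx
      (row_mx (mxC (hankel n U)) (0 : 'cV[R[i]]_n.+1))
      (row_mx (mxC (hankel n Y)) (gamma n.+1 sigma)))
  = (\rank (col_mx (mxC (hankel n U)) (mxC (hankel n Y))) + 1)%N.
Proof.
(* Regrouping by columns turns the three matrices into [row_mx (row_mx D b) a], [row_mx D b] and
   [D]. *)
rewrite -!block_mxEv !block_mxEh.
set D := col_mx (mxC _) (mxC _).
set b := col_mx 0 (gamma _ _).
have -> : col_mx (row_mx (mxC (hankel n U)) 0)
                 (row_mx (mxC (hankel n Y)) (gamma n.+1 sigma)) = row_mx D b.
  by rewrite -block_mxEv block_mxEh.
set a := col_mx (gamma _ _) 0.
have subP M : Sigma_data n U Y `<=` Sigma_value n sigma M <->
    ((a + M *: b)^T <= D^T)%MS.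
  rewrite /a /b /D scale_col_mx scaler0 add_col_mx addr0 add0r.
  rewrite /mxC -map_col_mx; split; first exact: submx_of_Sigma_value.
  exact: Sigma_value_of_submx.
have -> : informative_for_interpolation n U Y sigma <->
    exists! M, ((a + M *: b)^T <= D^T)%MS.
  by split=> -[M [/subP MD Muniq]]; exists M; split=> // N /subP /Muniq.
(* Each rank condition now fixes one boolean increment: 0 for adjoining [a], 1 for adjoining [b]. *)
rewrite unique_submx_shift -sub_tr_row_mx !mxrank_row_mx_col.
case: (_ <= _)%MS; case: (_ <= _)%MS; split=> //; lia.
Qed.
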